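(* Let $\mathbb D\subset\mathbb R^d$ be a non-empty closed set. Let $M=(M^1,\dots,M^d)$ be a regular local martingale field, and let $G=H+b$ be an admissible drift with decomposition such that $H$ satisfies the sublinear growth condition. Let $\Psi_{s,t}$ be the stochastic flow generated by $\mathrm d\psi^i(t)=b^i(t,\psi(t))\,\mathrm dt+M^i(\mathrm dt,\psi(t))$, and assume that $$\Psi_{s,t}(\mathbb D,\omega)=\mathbb D\quad\text{for all }t>s\ge 0,\ \omega\in\Omega .$$ Assume moreover that there exist $\varepsilon_0>0$ and a family of admissible drifts $G_\varepsilon=H_\varepsilon+b$, $\varepsilon\in(0,\varepsilon_0]$ (with the same $b$), such that: (i) each $H_\varepsilon$ satisfies the sublinear growth condition; (ii) $\lim_{\varepsilon\to0}H_\varepsilon(t,\eta,\omega)=H(t,\eta,\omega)$ for every $(t,\eta)\in[0,\infty)\times C_{\mathbb D}$ and $\omega\in\Omega$; (iii) for every $(t,\eta)\in[0,\infty)\times C_{\mathbb D}$, $\varepsilon\in(0,\varepsilon_0]$ and $\omega\in\Omega$ there exists $\alpha=\alpha(\varepsilon,t,\eta,\omega)>0$ such that $\eta(0)+hH_\varepsilon(t,\eta,\omega)+hu\in\mathbb D$ whenever $0<h\le\alpha$ and $u\in\mathbb R^d$, $|u|\le\alpha$; (iv) if $y^\varepsilon$ denotes the solution of the pathwise equation with $H_\varepsilon$ in place of $H$ and $x$ the solution of the pathwise equation with $H$, both with initial time $s$ and initial function $\eta$, then $\lim_{\varepsilon\to0}y^\varepsilon(t,\omega)=x(t,\omega)$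 for every $\omega\in\Omega$, $s\ge0$, $t\ge s$ and $\eta\in C$. Then $\mathbb D$ is forward invariant for the equation $\mathrm dx^i(t)=G^i(t,x_t)\,\mathrm dt+M^i(\mathrm dt,x(t))$, $i=1,\dots,d$, in the following sense: for any $\omega\in\Omega$, $s\ge0$ and $\eta\in C$ with $\eta(u)\in\mathbb D$ for all $u\in[-r,0]$, the (unique) solution $x$ of the pathwise equation with initial time $s$ and initial function $\eta$ satisfies $x(t,\omega)\in\mathbb D$ for all $t\ge s$.
   Context: Fix $r>0$, an integer $d\ge1$, and let $C=C([-r,0],\mathbb R^d)$ with the supremum norm $\|\cdot\|_C$. For a continuous function $x$ defined on a set containing $[s-r,s]$, $x_s\in C$ is $x_s(u)=x(s+u)$, $u\in[-r,0]$. For $\mathbb D\subset\mathbb R^d$, $C_{\mathbb D}=\{\eta\in C:\eta(u)\in\mathbb D\ \text{for every }u\in[-r,0]\}$. Let $(\Omega,\mathcal F,(\mathcal F_t)_{t\ge0},\mathbf P)$ be a filtered probability space satisfying the usual conditions. Regular local martingale field: $M^i:[0,\infty)\times\mathbb R^d\times\Omega\to\mathbb R$, $i=1,\dots,d$, such that (i) $M^i$ is continuous in the first two variables for each $\omega$; (ii) for each $x$, $M^i(\cdot,x)$ is a local martingale with $M^i(0,x,\omega)=0$ for all $\omega$; (iii) there are $\delta\in(0,1)$ and predictable processes $a^{ij}:[0,\infty)\times\mathbb R^{2d}\times\Omega\to\mathbb R$ with $\langle M^i(\cdot,x),M^j(\cdot,y)\rangle_t=\int_0^ta^{ij}(u,x,y,\omega)\,\mathrm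 du$ a.s. such that, with $\bar a^{ij}=\mathrm D_x\mathrm D_ya^{ij}$ (the matrix of mixed partial derivatives), $$R^{ij}(t,\omega)=\sup_{x,y}\frac{|a^{ij}(t,x,y)|}{(1+|x|)(1+|y|)}+\sup_{x,y}\|\bar a^{ij}(t,x,y)\|+\sup_{x\ne x',\,y\ne y'}\frac{\|\bar a^{ij}(t,x,y)-\bar a^{ij}(t,x,y')-\bar a^{ij}(t,x',y)+\bar a^{ij}(t,x',y')\|}{|x-x'|^\delta|y-y'|^\delta}$$ is finite and $t\mapsto R^{ij}(t,\omega)$ is locally integrable for every $\omega$ and all $i,j$. Admissible drift with decomposition $G=H+b$: $G:[0,\infty)\times C\times\Omega\to\mathbb R^d$ and $G(t,\eta,\omega)=H(t,\eta,\omega)+b(t,\eta(0),\omega)$, where each of $G$, $H$ (on $C$) and $b$ (on $\mathbb R^d$ in place of $C$) is (i) jointly continuous in the first two variables for each $\omega$; (ii) for each $\omega$, each $T>0$ and each bounded set $B$, Lipschitz in the second variable on $B$ with a constant $L(T,B,\omega)<\infty$ uniform in $t\in[0,T]$; (iii) $\mathcal F_t$-measurable at time $t$ for each fixed value of the second variable. Moreover $b(t,\cdot)$ is continuously differentiable and there are $\delta>0$ and $c(T,\omega)<\infty$ with $$\sup_{0\le t\le T}\Big\{\sup_x\|\mathrm Db(t,x,\omega)\|+\sup_{x\ne y}\frac{\|\mathrm Db(t,x,\omega)-\mathrm Db(t,y,\omega)\|}{|x-y|^\delta}\Big\}\le c(T,\omega).$$ Sublinear growth condition on $H$: for each $T>0$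 and $\omega\in\Omega$ there are $c=c(T,\omega)$ and $\gamma=\gamma(T,\omega)\in[0,1)$ with $|H(t,\eta,\omega)|\le c(1+\|\eta\|_C^\gamma)$ for all $0\le t\le T$, $\eta\in C$. Flow: $M^i(\mathrm dt,\cdot)$ denotes Kunita's stochastic differential. It is known (Kunita) that there is $\Psi:[0,\infty)^2\times\mathbb R^d\times\Omega\to\mathbb R^d$ such that for each $s,x$, $t\mapsto\Psi_{s,t}(x)$, $t\ge s$, solves $\mathrm d\psi^i=b^i(t,\psi)\,\mathrm dt+M^i(\mathrm dt,\psi)$ with $\psi(s)=x$; $\Psi_{s,s}(x,\omega)=x$; $(s,t,x)\mapsto\Psi_{s,t}(x,\omega)$ and $(s,t,x)\mapsto\mathrm D_x\Psi_{s,t}(x,\omega)$ are continuous for each $\omega$; each $\Psi_{s,t}(\cdot,\omega)$ is a $C^1$-diffeomorphism of $\mathbb R^d$; and $\Psi_{s,u}(\cdot,\omega)=\Psi_{t,u}(\cdot,\omega)\circ\Psi_{s,t}(\cdot,\omega)$ for all $s,t,u\ge0$ and all $\omega$. This $\Psi$ is fixed. Pathwise equation (with $H$, initial time $s\ge0$, initial function $\eta\in C$): with $\Psi(u,x,\omega)=\Psi_{0,u}(x,\omega)$, $\xi(u,x,\omega)=\Psi(u,\cdot,\omega)^{-1}(x)$, $F(u,x,\eta,\omega)=\{\mathrm D_x\Psi(u,x,\omega)\}^{-1}H(u,\eta,\omega)$, $$x(t,\omega)=\Psi\Big(t,\Big[\xi(s,\eta(0),\omega)+\int_s^tF\big(u,\xi(u,x(u,\omega),\omega),x_u(\omega),\omega\big)\,\mathrm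 du\Big],\omega\Big),\ t\ge s;\qquad x(t,\omega)=\eta(t-s),\ t\in[s-r,s].$$ It is equivalent to the stochastic functional differential equation $\mathrm dx^i(t)=G^i(t,x_t)\,\mathrm dt+M^i(\mathrm dt,x(t))$, $x_s=\eta$. If $M$ is a regular local martingale field and $G=H+b$ is an admissible drift with decomposition such that $H$ satisfies the sublinear growth condition, it is known that on a set of full measure the pathwise equation has a unique solution for all $t\ge s$, all $s\ge 0$ and all $\eta\in C$. Convention: a null set is discarded so that this holds for every $\omega\in\Omega$ (for $H$ and for every $H_\varepsilon$ under consideration). *)

(* Defs.v *)
From HB Require Import structures.
From mathcomp Require Import all_boot all_order all_algebra.
From mathcomp Require Import all_classical all_reals all_analysis.
Set Implicit Arguments.
Unset Strict Implicit.
Unset Printing Implicit Defensive.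
Import Order.TTheory GRing.Theory Num.Theory.
Import numFieldNormedType.Exports.
Local Open Scope classical_set_scope.
Local Open Scope ring_scope.

(* Points of R^d are row vectors.  All time-dependent objects are total
   functions of a real time; only their values at nonnegative times are ever
   constrained or used. *)

(* Euclidean norm of a vector, Frobenius norm of a matrix (the library norm
   `|_| of a matrix is the max norm). *)
Definition enorm {R : realType} {m n : nat} (A : 'M[R]_(m, n)) : R :=
  Num.sqrt (\sum_i \sum_j A i j ^+ 2).

Section PathSpace.
Context {R : realType} (r : {posnum R}) (d : nat).

Definition delays : set R := `[- r%:num, 0]%classic.

Definition pathC := continuousType delays 'rV[R]_d.

Lemma delay0_subproof : (0 : R) \in delays.
Proof. by rewrite inE /delays /= in_itv /= oppr_le0 lexx ge0. Qed.

Definition delay0 : delays := exist _ 0 delay0_subproof.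

Definition supnorm (eta : pathC) : R :=
  sup (range (fun u : delays => enorm (eta u))).

Definition supdist (eta zeta : pathC) : R :=
  sup (range (fun u : delays => enorm (eta u - zeta u))).

Definition path0 : pathC := cst (0 : 'rV[R]_d).

(* x_t; the default value is never used when x is continuous on a set
   containing [t - r, t]. *)
Definition segment (x : R -> 'rV[R]_d) (t : R) : pathC :=
  if pselect (continuous (fun u : delays => x (t + val u))) is left cx
  then mkcts cx else path0.

Definition pathC_in (D : set 'rV[R]_d) : set pathC :=
  [set eta | forall u : delays, D (eta u)].

End PathSpace.

Section StochasticBasis.
Context {R : realType} {dsp : measure_display} {T : measurableType dsp}.
Variables (P : probability T R) (F : R -> set (set T)).

Definition filtration_usual :=
  [/\ forall t, 0 <= t -> sigma_algebra setT (F t),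
      forall t, 0 <= t -> F t `<=` measurable,
      forall s t, 0 <= s -> s <= t -> F s `<=` F t,
      forall t A, 0 <= t -> (forall u, t < u -> F u A) -> F t A &
      forall A, P.-negligible A -> F 0 A].

Definition measurable_wrt (G : set (set T)) (X : T -> R) :=
  forall B : set R, measurable B -> G (X @^-1` B).

Definition vmeasurable_wrt (d : nat) (G : set (set T)) (X : T -> 'rV[R]_d) :=
  forall i, measurable_wrt G (fun w => X w ord0 i).

Definition adapted (X : R -> T -> R) :=
  forall t, 0 <= t -> measurable_wrt (F t) (X t).

Definition predictable_sets : set (set (R * T)) :=
  <<s [set p : R * T | 0 <= p.1],
      [set B | (exists2 A, F 0 A & B = [set 0] `*` A) \/
               (exists s t A, [/\ 0 <= s, s <= t, F s A &
                                  B = `]s, t]%classic `*` A])] >>.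

Definition predictable (X : R -> T -> R) :=
  forall B : set R, measurable B ->
    predictable_sets [set p | 0 <= p.1 /\ B (X p.1 p.2)].

Definition martingale (X : R -> T -> R) :=
  [/\ adapted X,
      forall t, 0 <= t -> P.-integrable setT (fun w => (X t w)%:E) &
      forall s t A, 0 <= s -> s <= t -> F s A ->
        (\int[P]_(w in A) (X t w)%:E = \int[P]_(w in A) (X s w)%:E)%E].

Definition stopping_time (tau : T -> \bar R) :=
  (forall w, (0 <= tau w)%E) /\
  (forall t, 0 <= t -> F t [set w | (tau w <= t%:E)%E]).

Definition stopped (X : R -> T -> R) (tau : T -> \bar R) (t : R) (w : T) : R :=
  X (fine (Order.min t%:E (tau w))) w.

(* Only applied to processes that vanish at time 0, so that stopping at tau_n
   needs no truncation or centering of the initial value. *)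
Definition local_martingale (X : R -> T -> R) :=
  adapted X /\
  exists tau : nat -> T -> \bar R,
    [/\ forall n, stopping_time (tau n),
        forall n w, (tau n w <= tau n.+1 w)%E,
        {ae P, forall w, tau n w @[n --> \oo] --> +oo%E} &
        forall n, martingale (stopped X (tau n))].

(* A is (a version of) the covariation <X, Y> of the continuous local
   martingales X and Y. *)
Definition covariation (X Y A : R -> T -> R) :=
  [/\ adapted A,
      forall w, A 0 w = 0,
      forall w, {within `[0, +oo[, continuous (A ^~ w)},
      forall w t, 0 <= t -> bounded_variation 0 t (A ^~ w) &
      local_martingale (fun t w => X t w * Y t w - A t w)].

(* Convergence to 0 in probability; the outer measure of P is used so that no
   measurability of Z n is presupposed. *)
Definition cvg0_in_probability (Z : nat -> T -> \bar R) :=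
  forall e : R, 0 < e ->
    mu_ext P [set w | (e%:E < `|Z n w|)%E] @[n --> \oo] --> 0%E.

End StochasticBasis.

Section MartingaleField.
Context {R : realType} {dsp : measure_display} {T : measurableType dsp}.
Variables (P : probability T R) (F : R -> set (set T)) (d : nat).
Local Notation V := 'rV[R]_d.

Definition unit_vec (k : 'I_d) : V := delta_mx ord0 k.

Definition mixedD (c : V -> V -> R) (x y : V) : 'M[R]_d :=
  \matrix_(k, l) 'D_(unit_vec k) (fun x' => 'D_(unit_vec l) (c x') y) x.

Definition mixed_derivable (c : V -> V -> R) :=
  forall x y k l,
    derivable (c x) y (unit_vec l) /\
    derivable (fun x' => 'D_(unit_vec l) (c x') y) x (unit_vec k).

(* The random variable R^{ij}(t), for c = a^{ij}(t, ., .). *)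
Definition field_bound (delta : R) (c : V -> V -> R) : \bar R :=
  (ereal_sup [set (`|c p.1 p.2| / ((1 + enorm p.1) * (1 + enorm p.2)))%:E
             | p in [set: V * V]]
   + ereal_sup [set (enorm (mixedD c p.1 p.2))%:E | p in [set: V * V]]
   + ereal_sup
       [set (enorm (mixedD c p.1.1 p.2.1 - mixedD c p.1.1 p.2.2
                    - mixedD c p.1.2 p.2.1 + mixedD c p.1.2 p.2.2)
             / (enorm (p.1.1 - p.1.2) `^ delta
                * enorm (p.2.1 - p.2.2) `^ delta))%:E
       | p in [set p : (V * V) * (V * V) | p.1.1 != p.1.2 /\ p.2.1 != p.2.2]])%E.

Definition regular_local_martingale_field
    (M : 'I_d -> R -> V -> T -> R)
    (delta : R) (a : 'I_d -> 'I_d -> R -> V -> V -> T -> R) :=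
  [/\ forall i w, {within [set p : R * V | 0 <= p.1],
                   continuous (fun p => M i p.1 p.2 w)},
      forall i x, local_martingale P F (fun t w => M i t x w),
      forall i x w, M i 0 x w = 0 &
      [/\ 0 < delta < 1,
          forall i j x y, predictable F (fun t w => a i j t x y w),
          forall i j x y, exists2 A,
            covariation P F (fun t w => M i t x w) (fun t w => M j t y w) A &
            forall t, 0 <= t -> {ae P, forall w, A t w =
              \int[lebesgue_measure]_(u in `[0, t]) a i j u x y w},
          forall i j t w, 0 <= t -> mixed_derivable (fun x y => a i j t x y w) &
          forall i j w,
            (forall t, 0 <= t ->
               (field_bound delta (fun x y => a i j t x y w) < +oo)%E) /\
            (forall t, 0 <= t -> lebesgue_measure.-integrable `[0, t]
               (fun u => field_bound delta (fun x y => a i j u x y w)))]].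

(* Kunita's integral: it is defined first for simple integrands, which equal
   the F_(tau k)-measurable v k on [tau k, tau k.+1[, and then by approximation,
   the squared distance between integrands f and g being
   \int (a(f, f) - a(f, g) - a(g, f) + a(g, g)) du. *)
Record simple_process := SimpleProcess {
  sp_size : nat;
  sp_time : nat -> R;
  sp_value : nat -> T -> V }.

Definition simple_on (s t : R) (f : simple_process) :=
  [/\ sp_time f 0%N = s, sp_time f (sp_size f) = t,
      forall k, (k < sp_size f)%N -> sp_time f k <= sp_time f k.+1 &
      forall k, (k < sp_size f)%N ->
        vmeasurable_wrt (F (sp_time f k)) (sp_value f k)].

Definition sp_eval (f : simple_process) (u : R) (w : T) : V :=
  \sum_(k < sp_size f | sp_time f k <= u < sp_time f k.+1) sp_value f k w.

Definition sp_integral (m : R -> V -> T -> R) (f : simple_process)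
    (t : R) (w : T) : R :=
  \sum_(k < sp_size f)
    (m (Num.min (sp_time f k.+1) t) (sp_value f k w) w
     - m (Num.min (sp_time f k) t) (sp_value f k w) w).

(* I t = \int_s^t m(du, f u), where c is the local characteristic of m. *)
Definition kunita_integral (m : R -> V -> T -> R) (c : R -> V -> V -> T -> R)
    (s : R) (f : R -> T -> V) (I : R -> T -> R) :=
  forall t1, s <= t1 -> exists fn : nat -> simple_process,
    [/\ forall n, simple_on s t1 (fn n),
        cvg0_in_probability P (fun n w =>
          \int[lebesgue_measure]_(u in `[s, t1])
            (c u (sp_eval (fn n) u w) (sp_eval (fn n) u w) w
             - c u (sp_eval (fn n) u w) (f u w) w
             - c u (f u w) (sp_eval (fn n) u w) w
             + c u (f u w) (f u w) w)%:E)%E &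
        cvg0_in_probability P (fun n w =>
          ereal_sup [set (`|I t w - sp_integral m (fn n) t w|)%:E
                    | t in `[s, t1]])].

Definition C1_map (f : V -> V) :=
  (forall x, differentiable f x) /\ continuous (fun x => 'J f x : 'M[R]_d).

Definition C1_diffeo (f : V -> V) :=
  C1_map f /\ exists g, [/\ cancel f g, cancel g f & C1_map g].

Definition solves_sde (M : 'I_d -> R -> V -> T -> R)
    (a : 'I_d -> 'I_d -> R -> V -> V -> T -> R) (b : R -> V -> T -> V)
    (s : R) (x : V) (psi : R -> T -> V) :=
  [/\ forall w, {within `[s, +oo[, continuous (psi ^~ w)},
      forall t, s <= t -> vmeasurable_wrt (F t) (psi t) &
      exists2 I : 'I_d -> R -> T -> R,
        forall i, kunita_integral (M i) (a i i) s psi (I i) &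
        {ae P, forall w, forall i t, s <= t ->
           psi t w ord0 i = x ord0 i
             + \int[lebesgue_measure]_(u in `[s, t]) (b u (psi u w) w ord0 i)
             + I i t w}].

Definition stochastic_flow (M : 'I_d -> R -> V -> T -> R)
    (a : 'I_d -> 'I_d -> R -> V -> V -> T -> R) (b : R -> V -> T -> V)
    (Psi : R -> R -> V -> T -> V) :=
  let times := [set p : R * R * V | 0 <= p.1.1 /\ 0 <= p.1.2] in
  [/\ forall s x, 0 <= s -> solves_sde M a b s x (fun t w => Psi s t x w),
      forall s x w, 0 <= s -> Psi s s x w = x,
      (forall w, {within times, continuous
          (fun p : R * R * V => Psi p.1.1 p.1.2 p.2 w)}) /\
      (forall w, {within times, continuous
          (fun p : R * R * V =>
             'J (fun x => Psi p.1.1 p.1.2 x w) p.2 : 'M[R]_d)}),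
      forall s t w, 0 <= s -> 0 <= t -> C1_diffeo (fun x => Psi s t x w) &
      forall s t u x w, 0 <= s -> 0 <= t -> 0 <= u ->
        Psi s u x w = Psi t u (Psi s t x w) w].

End MartingaleField.

Section Drift.
Context {R : realType} {dsp : measure_display} {T : measurableType dsp}.
Variables (F : R -> set (set T)) (r : {posnum R}) (d : nat).
Local Notation V := 'rV[R]_d.
Local Notation C := (pathC r d).

(* Used with E = C([-r,0], R^d) for G and H, and with E = R^d for b. *)
Definition drift_regular (E : Type) (nrm : E -> R) (dst : E -> E -> R)
    (f : R -> E -> T -> V) :=
  [/\ forall w t x, 0 <= t -> forall e, 0 < e -> exists2 h, 0 < h &
        forall t' x', 0 <= t' -> `|t' - t| < h -> dst x' x < h ->
          enorm (f t' x' w - f t x w) < e,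
      forall w t1 (B : set E), 0 < t1 ->
        (exists K, forall x, B x -> nrm x <= K) ->
        exists L, forall t x y, 0 <= t <= t1 -> B x -> B y ->
          enorm (f t x w - f t y w) <= L * dst x y &
      forall t x, 0 <= t -> vmeasurable_wrt (F t) (f t x)].

Definition smooth_drift (b : R -> V -> T -> V) :=
  (forall t w, 0 <= t -> C1_map (fun x => b t x w)) /\
  exists2 delta : R, 0 < delta &
  forall t1 w, 0 < t1 -> exists c : R, forall t, 0 <= t <= t1 ->
    let Db := jacobian (fun x => b t x w) in
    (ereal_sup [set (enorm (Db x))%:E | x in [set: V]]
     + ereal_sup [set (enorm (Db p.1 - Db p.2)
                       / enorm (p.1 - p.2) `^ delta)%:E
                 | p in [set p : V * V | p.1 != p.2]] <= c%:E)%E.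

Definition admissible_drift (G H : R -> C -> T -> V) (b : R -> V -> T -> V) :=
  [/\ forall t eta w, 0 <= t -> G t eta w = H t eta w + b t (eta (delay0 r)) w,
      drift_regular (@supnorm R r d) (@supdist R r d) G,
      drift_regular (@supnorm R r d) (@supdist R r d) H,
      drift_regular (@enorm R 1 d) (fun x y => enorm (x - y)) b &
      smooth_drift b].

Definition sublinear_growth (H : R -> C -> T -> V) :=
  forall t1 w, 0 < t1 -> exists c gamma : R, 0 <= gamma < 1 /\
    forall t eta, 0 <= t <= t1 ->
      enorm (H t eta w) <= c * (1 + supnorm eta `^ gamma).

End Drift.

Section PathwiseEquation.
Context {R : realType} {T : Type} (r : {posnum R}) (d : nat).
Local Notation V := 'rV[R]_d.
Local Notation C := (pathC r d).
Variables (Psi : R -> R -> V -> T -> V) (H : R -> C -> T -> V).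

Definition xi (u : R) (x : V) (w : T) : V :=
  'pinv_(fun=> 0) setT (fun y => Psi 0 u y w) x.

(* (D_x Psi)^-1 H for row vectors: v *m 'J f x is the differential of f at x
   applied to v. *)
Definition pulled_drift (u : R) (x : V) (eta : C) (w : T) : V :=
  H u eta w *m invmx ('J (fun y => Psi 0 u y w) x).

Definition vintegral (s t : R) (f : R -> V) : V :=
  \row_i \int[lebesgue_measure]_(u in `[s, t]) (f u ord0 i).

Definition pathwise_solution (w : T) (s : R) (eta : C) (x : R -> V) :=
  [/\ {within `[s - r%:num, +oo[, continuous x},
      forall u : delays r, x (s + val u) = eta u &
      forall t, s <= t ->
        x t = Psi 0 t
          (xi s (eta (delay0 r)) w
           + vintegral s t (fun u =>
               pulled_drift u (xi u (x u) w) (segment r x u) w)) w].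

Definition pathwise_well_posed :=
  forall w s eta, 0 <= s ->
    (exists x, pathwise_solution w s eta x) /\
    (forall x y, pathwise_solution w s eta x -> pathwise_solution w s eta y ->
       forall t, s - r%:num <= t -> x t = y t).

Definition forward_invariant (D : set V) :=
  forall w s eta x, 0 <= s -> pathC_in D eta ->
    pathwise_solution w s eta x -> forall t, s <= t -> D (x t).

End PathwiseEquation.

(* Main.v *)
Require Import Defs.
From HB Require Import structures.
From mathcomp Require Import all_boot all_order all_algebra.
From mathcomp Require Import all_classical all_reals all_analysis.
Import Order.TTheory GRing.Theory Num.Theory.
Import numFieldNormedType.Exports.
Local Open Scope classical_set_scope.
Local Open Scope ring_scope.

(** The argument is deterministic: the sample point [w] is fixed throughout.

    A solution of the pathwise equation has the form [y t = Psi 0 t (Z t)],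
    where [Z] is an integral of the pulled back drift.  For a time [t0] consider
    the transported curve [W t = Psi 0 t0 (Z t)].  It satisfies
    [y t = Psi t0 t (W t)], and since [Psi t0 t] maps [D] onto [D], the solution
    is in [D] at a time [t > t0] as soon as [W t] is
    ([pathwise_solution_lift], [transported_derive]).  The flow has been removed
    from [W]: the inverse Jacobian in the pathwise equation is cancelled by the
    Jacobian of [Psi 0 t0], so [W] has derivative [H t0 y_t0] at [t0].  Hence
    [W (t0 + h) = y t0 + h H(t0, y_t0) + o(h)].

    If the drift points strictly into [D] and [y] has stayed in [D] up to [t0],
    the error [o(h)] is absorbed by the margin [alpha] of that condition, so
    [W (t0 + h)], and with it [y (t0 + h)], lies in [D] for all small [h > 0]
    ([inward_derivative_enters]).  As [D] is closed, a continuous curve that can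
    always be continued inside [D] never leaves it
    ([closed_set_continuation]).  Thus the solutions for the strictly inward
    drifts [He eps] stay in [D] ([inward_drift_invariant]), and so does their
    limit as [eps] tends to [0].

    The derivative of [Z] comes from the fundamental theorem of calculus, which
    needs a continuous integrand; this rests on two facts.  The segment [y_t]
    depends continuously on [t] in the supremum norm ([segment_cvg]), and the
    inverse of the Jacobian of [Psi 0 u] is the Jacobian of [Psi u 0]
    ([pulled_drift_flow]), whose joint continuity is part of the hypotheses on
    the flow. *)

(** * Norms, limits and composition *)

Section VectorNorms.
Context {R : realType}.

Lemma enormE n (v : 'rV[R]_n) : enorm v = Num.sqrt (\sum_j v ord0 j ^+ 2).
Proof. by rewrite /enorm big_ord1. Qed.

Lemma enorm_ge0 m n (A : 'M[R]_(m, n)) : 0 <= enorm A.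
Proof. exact: sqrtr_ge0. Qed.

Lemma normr_le_enorm n (v : 'rV[R]_n) : `|v| <= enorm v.
Proof.
rewrite [leLHS]/Num.Def.normr/= mx_normrE (bigmax_le _ (enorm_ge0 _ _ _))//= => -[i j] _ /=.
rewrite enormE -sqrtr_sqr ler_sqrt; last by apply: sumr_ge0 => k _; exact: sqr_ge0.
rewrite (ord1 i) (bigD1 j) //= lerDl; apply: sumr_ge0 => k _; exact: sqr_ge0.
Qed.

Lemma enorm_le_normr n (v : 'rV[R]_n) : enorm v <= Num.sqrt n%:R * `|v|.
Proof.
have vE : `|v| = Num.sqrt (`|v| ^+ 2) by rewrite sqrtr_sqr normr_id.
rewrite enormE vE -sqrtrM // ler_sqrt; last first.
  by rewrite mulr_ge0 // sqr_ge0.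
have -> : n%:R * `|v| ^+ 2 = \sum_(j < n) `|v| ^+ 2.
  by rewrite sumr_const card_ord mulr_natl.
apply: ler_sum => j _; rewrite -[leLHS]real_normK ?num_real// lerXn2r ?nnegrE//.
rewrite [leRHS]/Num.Def.normr/= mx_normrE.
exact: (le_bigmax _ (fun ij : 'I_1 * 'I_n => `|v ij.1 ij.2|) (ord0, j)).
Qed.

Lemma cvg_mx_entries (T : Type) (F : set_system T) (FF : Filter F) m n
    (M : T -> 'M[R]_(m, n)) (l : 'M[R]_(m, n)) :
  (forall i j, (fun x => M x i j) @ F --> l i j) -> M @ F --> l.
Proof.
move=> Ml; apply/cvgrPdist_le => /= e e0.
near=> x.
rewrite [leLHS]/Num.Def.normr/= mx_normrE (bigmax_le _ (ltW e0))//= => i _.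
rewrite !mxE/=.
move: i; near: x; apply: filter_forall => /= i.
exact: (iffLR (cvgrPdist_le _ _) (Ml i.1 i.2)).
Unshelve. all: by end_near. Qed.

Lemma cvg_mulmx (T : Type) (F : set_system T) (FF : Filter F) m n p
    (A : T -> 'M[R]_(m, n)) (B : T -> 'M[R]_(n, p))
    (a : 'M[R]_(m, n)) (b : 'M[R]_(n, p)) :
  A @ F --> a -> B @ F --> b -> (fun x => A x *m B x) @ F --> a *m b.
Proof.
move=> Aa Bb; apply: cvg_mx_entries => i j; rewrite mxE.
under eq_fun do rewrite mxE.
apply: (cvg_big (op := +%R)) => [|k _]; first exact: add_continuous.
apply: cvgM.
  exact: (cvg_comp _ _ Aa (@coord_continuous _ _ _ i k a)).
exact: (cvg_comp _ _ Bb (@coord_continuous _ _ _ k j b)).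
Qed.

End VectorNorms.

(** Turns continuity on a set, such as a half-line of times, into continuity
    everywhere, by composition with a map into that set, such as [Num.max a]. *)
Lemma continuous_within_comp (X Y Z : topologicalType) (A : set X) (f : X -> Y)
    (g : Z -> X) :
  {within A, continuous f} -> continuous g -> (forall z, A (g z)) ->
  continuous (f \o g).
Proof.
move=> fA gc Ag z.
have fz : f @ within A (nbhs (g z)) --> f (g z).
  by rewrite nbhs_subspace_in//; exact: fA.
apply: cvg_comp fz => P /gc; rewrite /= !nbhs_simpl /=.
by apply: filterS => z' /(_ (Ag z')).
Qed.

Lemma near_comp (X Z : topologicalType) (f : Z -> X) z (P : X -> Prop) :
  {for z, continuous f} -> (\forall x \near f z, P x) ->
  \forall z' \near z, P (f z').
Proof. by move=> cf /cf. Qed.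

(** * Segments of a path *)

Section Segments.
Context {R : realType} {r : {posnum R}} {d : nat}.
Local Notation V := 'rV[R]_d.

Lemma eq_segment (x y : R -> V) t :
  (forall u : delays r, x (t + val u) = y (t + val u)) ->
  segment r x t = segment r y t.
Proof.
move=> xy; rewrite /segment.
by have -> : (fun u : delays r => x (t + val u)) = (fun u => y (t + val u))
  by exact/funext.
Qed.

Lemma segment_continuous (x : R -> V) t u : continuous x ->
  segment r x t u = x (t + val u).
Proof.
move=> cx; rewrite /segment; case: pselect => // -[] v.
apply: (@continuous_comp _ _ _ (fun u : delays r => t + val u) x); last exact: cx.
apply: continuousD; first exact: cst_continuous.
exact: initial_continuous.
Qed.

Lemma continuous_extension (a : R) (x : R -> V) :
  {within `[a, +oo[, continuous x} ->
  exists2 y : R -> V, continuous y & forall u, a <= u -> y u = x u.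
Proof.
move=> cx; exists (fun u => x (Num.max a u)) => [|u au]; last by rewrite max_r.
apply: (continuous_within_comp _ _ _ _ _ (Num.max a) cx) => u.
  by apply: continuous_max; [exact: cvg_cst|exact: cvg_id].
by rewrite /= in_itv /= andbT le_max lexx.
Qed.

Lemma delays_itv (u : delays r) : - r%:num <= val u <= 0.
Proof. by have := set_valP u; rewrite /delays /= in_itv. Qed.

Lemma segment_within (a t : R) (x : R -> V) (u : delays r) :
  {within `[a, +oo[, continuous x} -> a + r%:num <= t ->
  segment r x t u = x (t + val u).
Proof.
move=> /continuous_extension[y cy yx] at'.
have yE (v : delays r) : y (t + val v) = x (t + val v).
  apply: yx; have /andP[rv _] := delays_itv v.
  by rewrite -(lerD2r r%:num) (le_trans at')// -addrA lerDl -lerBlDr sub0r.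
by rewrite -(eq_segment y x t yE) segment_continuous.
Qed.

(** Continuity of [t' |-> x_t'] for the supremum distance.  The difference
    [x (t' + u) - x (t + u)] is jointly continuous in [(u, t')] and vanishes at
    [t' = t], so it is small near each [(u, t)], and uniformly in [u] because
    [[- r, 0]] is compact. *)
Lemma segment_cvg (x : R -> V) t e : continuous x -> 0 < e ->
  \forall t' \near t, supdist (segment r x t') (segment r x t) < e.
Proof.
move=> cx e0.
have /compact_near_coveringP := @segment_compact R (- r%:num) 0.
move=> /(_ R (nbhs t) (fun t' u => enorm (x (t' + u) - x (t + u)) < e / 2) _) cov.
have e2 : 0 < e / 2 by rewrite divr_gt0.
have : \forall t' \near t, `[- r%:num, 0]%classic `<=`
    [set u | enorm (x (t' + u) - x (t + u)) < e / 2].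
  apply: cov => u _.
  have cf : continuous (fun p : R * R => x (p.2 + p.1) - x (t + p.1)).
    move=> p; apply: cvgB.
      apply: (continuous_comp (f := fun p : R * R => p.2 + p.1)); last exact: cx.
      by apply: cvgD; [exact: cvg_snd|exact: cvg_fst].
    apply: (continuous_comp (f := fun p : R * R => t + p.1)); last exact: cx.
    by apply: cvgD; [exact: cvg_cst|exact: cvg_fst].
  (* The [+ 1] keeps the norm comparison constant positive when [d = 0]. *)
  have K0 : 0 < Num.sqrt d%:R + 1 :> R.
    by rewrite ltr_wpDl // sqrtr_ge0.
  have H := iffLR (@cvgrPdist_lt _ _ _ _ _ _ _) (cf (u, t)) _ (divr_gt0 e2 K0).
  apply: (filterS _ (H _)) => -[u' t'] /=; rewrite subrr sub0r normrN ltr_pdivlMr // => /= h.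
  apply: le_lt_trans h; apply: (le_trans (enorm_le_normr _ _)).
  by rewrite mulrC ler_wpM2l // lerDl.
apply: filterS => t' Ht'.
have E : (fun u : delays r => enorm (segment r x t' u - segment r x t u)) =
    (fun u : delays r => enorm (x (t' + val u) - x (t + val u))).
  apply/funext => u.
  by congr (enorm (_ - _)); exact: segment_continuous.
rewrite /supdist E.
apply: (@le_lt_trans _ _ (e / 2)); last by rewrite gtr_pMr// invf_lt1 ?ltr1n.
apply: ge_sup; first by eexists; exists (delay0 r).
move=> _ [u _ <-]; apply/ltW/Ht'.
by rewrite /= in_itv /= delays_itv.
Qed.

End Segments.

(** * Integrals of vector-valued functions *)

Section VectorIntegrals.
Context {R : realType} {d : nat}.
Local Notation V := 'rV[R]_d.
Local Notation mu := (@lebesgue_measure R).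
Implicit Type f : R -> V.

Lemma eq_vintegral f g (s t : R) :
  (forall u, s <= u <= t -> f u = g u) -> vintegral s t f = vintegral s t g.
Proof.
move=> fg; apply/rowP => i; rewrite !mxE; apply: eq_Rintegral => u.
by rewrite inE /= in_itv /= => /fg ->.
Qed.

Lemma continuous_coord_integrable f i (s t : R) : continuous f ->
  mu.-integrable `[s, t] (EFin \o (fun u => f u ord0 i)).
Proof.
move=> cf; apply: continuous_compact_integrable; first exact: segment_compact.
apply: continuous_subspaceT => u.
exact: (continuous_comp (cf u) (@coord_continuous _ _ _ ord0 i _)).
Qed.

Lemma vintegral_split f (q s t : R) : continuous f -> q <= s -> s <= t ->
  vintegral s t f = vintegral q t f - vintegral q s f.
Proof.
move=> cf qs st; apply/rowP => i; rewrite !mxE.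
rewrite Rintegral_itvB ?bnd_simp//; last exact: continuous_coord_integrable.
rewrite Rintegral_itv_obnd_cbnd//.
apply: integrableS (continuous_coord_integrable f i s t cf) => //.
by apply: subset_itvr; rewrite bnd_simp.
Qed.

Lemma is_derive_vintegral f (q t : R) : continuous f -> q < t ->
  is_derive t 1 (fun u => vintegral q u f) (f t).
Proof.
move=> cf qt.
have t1 : t < t + 1 by rewrite ltrDl.
have ftc i := @continuous_FTC1_closed R (fun u => f u ord0 i) q t (t + 1)
  t1 (continuous_coord_integrable f i q (t + 1) cf) qt
  (continuous_comp (cf t) (@coord_continuous _ _ _ ord0 i _)).
have dv : derivable (fun u => vintegral q u f) t 1.
  apply/derivable_mxP => i j.
  under eq_fun do rewrite mxE.
  exact: (ftc j).1.
split=> //; rewrite derive_mx//; apply/rowP => i; rewrite mxE.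
under eq_fun do rewrite mxE.
by rewrite -derive1E; exact: (ftc i).2.
Qed.

End VectorIntegrals.

(** * Deterministic flows *)

Section Flows.
Context {R : realType} {d : nat}.
Local Notation V := 'rV[R]_d.

Lemma jacobian_cancel (f g : V -> V) x : cancel f g ->
  differentiable f x -> differentiable g (f x) ->
  'J f x *m 'J g (f x) = 1%:M.
Proof.
move=> fK df dg; apply/row_matrixP => i.
rewrite !rowE mulmx1 mulmxA /jacobian !mul_rV_lin1.
have gf : g \o f = id by apply/funext => z /=; rewrite fK.
have := diff_comp df dg.
by rewrite gf [in LHS]diff_val => /(congr1 (@^~ (delta_mx 0 i))).
Qed.

(** What a stochastic flow provides for one sample point. *)
Definition C1_flow (psi : R -> R -> V -> V) :=
  [/\ forall s x, 0 <= s -> psi s s x = x,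
      forall s t u x, 0 <= s -> 0 <= t -> 0 <= u ->
        psi s u x = psi t u (psi s t x),
      forall s t x, 0 <= s -> 0 <= t -> differentiable (psi s t) x &
      {within [set p : R * R * V | 0 <= p.1.1 /\ 0 <= p.1.2], continuous
          (fun p : R * R * V => 'J (psi p.1.1 p.1.2) p.2 : 'M[R]_d)}].

Lemma C1_flow_cancel (psi : R -> R -> V -> V) (s t : R) : C1_flow psi ->
  0 <= s -> 0 <= t -> cancel (psi s t) (psi t s).
Proof. by move=> [psi1 psiM _ _] s0 t0 x; rewrite -psiM // psi1. Qed.

Lemma xi_flow (T : Type) (Psi : R -> R -> V -> T -> V) w u x :
  C1_flow (fun s t y => Psi s t y w) -> 0 <= u ->
  xi Psi u x w = Psi u 0 x w.
Proof.
move=> fl u0; rewrite /xi; set f := fun y => Psi 0 u y w.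
have fK := C1_flow_cancel _ _ _ fl (lexx 0) u0.
have fKV := C1_flow_cancel _ _ _ fl u0 (lexx 0).
have xf : x \in f @` setT by rewrite inE; exists (Psi u 0 x w) => //; exact: fKV.
by rewrite -[LHS]fK /=; congr (Psi u 0 _ w); exact: (pinvK _ xf).
Qed.

(** [Psi u 0] is the inverse of [Psi 0 u], so its Jacobian is the inverse matrix;
    this removes both inversions from the pathwise equation. *)
Lemma pulled_drift_flow (r : {posnum R}) (T : Type) (Psi : R -> R -> V -> T -> V)
    (H : R -> pathC r d -> T -> V) w u x eta :
  C1_flow (fun s t y => Psi s t y w) -> 0 <= u ->
  pulled_drift Psi H u (xi Psi u x w) eta w =
  H u eta w *m 'J (fun y => Psi u 0 y w) x.
Proof.
move=> fl u0; rewrite /pulled_drift xi_flow //; congr (_ *m _).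
set A := 'J _ _; set B := 'J _ x.
have [_ _ dpsi _] := fl.
have AB : A *m B = 1%:M.
  have fKV := C1_flow_cancel _ _ _ fl u0 (lexx 0).
  rewrite -(jacobian_cancel _ _ _ (C1_flow_cancel _ _ _ fl (lexx 0) u0)
    (dpsi 0 u (Psi u 0 x w) (lexx 0) u0) (dpsi u 0 _ u0 (lexx 0))).
  by rewrite /B -[x in LHS](fKV x).
have /mulmx1_unit[Au _] := AB.
by rewrite -[RHS](mulKmx Au) AB mulmx1.
Qed.

End Flows.

(** * Curves pushed into a closed set *)

Section InwardDrift.
Context {R : realType} {d : nat}.
Local Notation V := 'rV[R]_d.

Lemma right_difference_quotient_cvg (W : R -> V) (t : R) v : is_derive t 1 W v ->
  h^-1 *: (W (t + h) - W t) - v @[h --> 0^'+] --> (0 : V).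
Proof.
move=> [dW <-]; rewrite -[X in _ --> X](subrr ('D_1 W t)).
apply: cvgB; last exact: cvg_cst.
have : (fun h => h^-1 *: (W (h *: 1 + t) - W t)) @ 0^' --> 'D_1 W t by exact: dW.
under eq_fun do rewrite [_%:A]mulr1 [_ + t]addrC.
move=> + P PW => /(_ P PW); rewrite /= !nbhs_simpl /= /dnbhs /at_right /within /=.
by apply: filterS => h hP h0; apply: hP; rewrite gt_eqF.
Qed.

(** With [u = (W (t + h) - W t) / h - v] one has exactly
    [W (t + h) = W t + h v + h u], and [u] tends to [0], so the margin [alpha]
    covers it for small [h]. *)
Lemma inward_derivative_enters (D : set V) (W : R -> V) (t alpha : R) v :
  is_derive t 1 W v -> 0 < alpha ->
  (forall h u, 0 < h <= alpha -> enorm u <= alpha -> D (W t + h *: v + h *: u)) ->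
  \forall h \near 0^'+, D (W (t + h)).
Proof.
move=> dW a0 inw.
have K0 : 0 < Num.sqrt d%:R + 1 :> R by rewrite ltr_wpDl // sqrtr_ge0.
have H := iffLR (@cvgrPdist_lt _ _ _ _ _ _ _)
  (right_difference_quotient_cvg _ _ _ dW) _ (divr_gt0 a0 K0).
near=> h.
have h0 : 0 < h by near: h; exact: nbhs_right_gt.
have ha : h <= alpha by near: h; exact: nbhs_right_le.
have : `|0 - (h^-1 *: (W (t + h) - W t) - v)| < alpha / (Num.sqrt d%:R + 1).
  by near: h; exact: H.
rewrite sub0r normrN ltr_pdivlMr //; set u := _ - v => hu.
have -> : W (t + h) = W t + h *: v + h *: u.
  rewrite -addrA -scalerDr /u [v + _]addrC subrK scalerA mulfV ?gt_eqF//.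
  by rewrite scale1r addrC subrK.
apply: inw; first by rewrite h0.
apply: le_trans (enorm_le_normr _ _) _.
by apply: le_trans (ltW hu); rewrite mulrC ler_wpM2l // lerDl.
Unshelve. all: by end_near. Qed.

(** At the infimum [m] of the times outside [D] the curve is still in [D], by
    closedness, and then it stays there for a while after [m]. *)
Lemma closed_set_continuation (D : set V) (y : R -> V) (s : R) :
  closed D -> {within `[s, +oo[, continuous y} -> D (y s) ->
  (forall t, s <= t -> (forall u, s <= u <= t -> D (y u)) ->
     \forall h \near 0^'+, D (y (t + h))) ->
  forall t, s <= t -> D (y t).
Proof.
move=> cD cy Dys step t st; apply: contrapT => nDt.
pose A := [set u | s <= u /\ ~ D (y u)].
have At : A t by [].
have lA : lbound A s by move=> u [].
have hA : has_inf A by split; [exists t|exists s].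
set m := inf A.
have sm : s <= m by apply: lb_le_inf => //; exists t.
have Dlt u : s <= u -> u < m -> D (y u).
  move=> su um; apply: contrapT => nDu.
  by move: um; rewrite ltNge ge_inf //; exists s.
have Dm : D (y m).
  move: sm; rewrite le_eqVlt => /predU1P[<- //|sm].
  have cm : y u @[u --> m^'-] --> y m.
    apply: cvg_at_left_filter.
    move: cy => /continuous_within_itvcyP[+ _]; apply.
    by rewrite in_itv /= sm.
  apply: (closed_cvg D cD _ (y m) cm).
  near=> u; apply: Dlt; last by near: u; exact: nbhs_left_lt.
  by near: u; exact: nbhs_left_ge.
have Dle u : s <= u <= m -> D (y u).
  by move=> /andP[su]; rewrite le_eqVlt => /predU1P[->//|]; exact: Dlt.
have [e /= e0 He] := step m sm Dle.
have [u Au ume] := inf_adherent e0 hA.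
have [su nDu] := Au.
have mu : m <= u by apply: ge_inf => //; exists s.
apply: nDu; move: mu; rewrite le_eqVlt => /predU1P[<-//|mu].
rewrite -(subrK m u) addrC; apply: He; rewrite /= ?subr_gt0//.
by rewrite sub0r normrN gtr0_norm ?subr_gt0// ltrBlDl.
Unshelve. all: by end_near. Qed.

End InwardDrift.

(** * Solutions of the pathwise equation *)

Section PathwiseSolutions.
Context {R : realType} {T : Type} {r : {posnum R}} {d : nat}.
Local Notation V := 'rV[R]_d.
Local Notation C := (pathC r d).
Variables (Psi : R -> R -> V -> T -> V) (H : R -> C -> T -> V) (w : T).
Hypothesis flow : C1_flow (fun s t x => Psi s t x w).
Hypothesis H_continuous : forall t eta, 0 <= t -> forall e, 0 < e ->
  exists2 h, 0 < h & forall t' eta', 0 <= t' -> `|t' - t| < h ->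
    supdist eta' eta < h -> enorm (H t' eta' w - H t eta w) < e.

Definition lifted_drift (Y : R -> V) (u : R) : V :=
  H u (segment r Y u) w *m 'J (fun x => Psi u 0 x w) (Y u).

(** The time change [m] is [Num.max s] below: it keeps all times nonnegative, so
    that continuity holds on the whole line. *)
Lemma lifted_drift_continuous (m : R -> R) (Y : R -> V) :
  continuous m -> (forall u, 0 <= m u) -> continuous Y ->
  continuous (lifted_drift Y \o m).
Proof.
move=> cm m0 cY.
have cH : continuous (fun u => H (m u) (segment r Y (m u)) w).
  move=> u; apply/cvgrPdist_lt => e e0.
  have [h h0 Hh] := H_continuous (m u) (segment r Y (m u)) (m0 u) e e0.
  have near_seg := near_comp _ _ m u _ (cm u) (segment_cvg Y (m u) h cY h0).
  have near_time := iffLR (@cvgrPdist_lt _ _ _ _ _ _ _) (cm u) h h0.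
  near=> u'.
  rewrite distrC; apply: le_lt_trans (normr_le_enorm _ _) _.
  apply: (Hh _ _ (m0 u')).
    by rewrite distrC; near: u'; exact: near_time.
  by near: u'; exact: near_seg.
have [_ _ _ cJ] := flow.
have cJY : continuous (fun u => 'J (fun x => Psi (m u) 0 x w) (Y (m u)) : 'M[R]_d).
  apply: (continuous_within_comp _ _ _ _ _
    (fun u : R => (m u, 0, Y (m u))) cJ) => [u|u]; last by rewrite /= m0 lexx.
  have cYm := @continuous_comp _ _ _ m Y u (cm u) (cY (m u)).
  exact: (cvg_pair (cvg_pair (cm u) (cvg_cst _)) cYm).
by move=> u; apply: cvg_mulmx; [exact: cH|exact: cJY].
Unshelve. all: by end_near. Qed.

(** The derivative is two-sided also at the initial time [s], because [Z] is
    built from an integrand that is extended continuously to the left of [s]. *)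
Lemma pathwise_solution_lift s eta y : 0 <= s ->
  pathwise_solution Psi H w s eta y ->
  exists Z : R -> V, forall t, s <= t -> y t = Psi 0 t (Z t) w /\
    is_derive t 1 Z (H t (segment r y t) w *m 'J (fun x => Psi t 0 x w) (y t)).
Proof.
move=> s0 [cy _ yE].
have [Y cY yY] := continuous_extension _ _ cy.
have sr : s - r%:num <= s by rewrite lerBlDr lerDl.
have segY t : s <= t -> segment r Y t = segment r y t.
  move=> st; apply: eq_segment => u; apply: yY.
  by rewrite lerD//; have /andP[] := delays_itv u.
pose f := lifted_drift Y \o Num.max s.
have cf : continuous f.
  apply: lifted_drift_continuous => // u; last by rewrite le_max s0.
  by apply: continuous_max; [exact: cvg_cst|exact: cvg_id].
have fE t : s <= t ->
    f t = H t (segment r y t) w *m 'J (fun x => Psi t 0 x w) (y t).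
  move=> st; rewrite /f /= (max_r st) /lifted_drift (segY t st) (yY t (le_trans sr st)).
  by [].
(* Integrating from [s - 1] makes [s] an interior point, where the
   fundamental theorem of calculus applies. *)
pose c := xi Psi s (eta (delay0 r)) w - vintegral (s - 1) s f.
exists (fun t => c + vintegral (s - 1) t f) => t st.
have s1 : s - 1 < s by rewrite ltrBlDr ltrDl ltr01.
split; last first.
  rewrite -fE // -[f t]add0r; apply: is_deriveD.
  by apply: is_derive_vintegral => //; exact: lt_le_trans st.
rewrite yE //; congr (Psi 0 t _ w).
rewrite /c -addrA [- _ + _]addrC -(vintegral_split _ _ _ _ cf (ltW s1) st).
congr (_ + _); apply: eq_vintegral => u /andP[su _].
by rewrite fE // pulled_drift_flow // (le_trans s0).
Qed.

(** The chain rule multiplies [v *m 'J (Psi t 0)] by the Jacobian of the inverse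
    map [Psi 0 t]. *)
Lemma transported_derive (t : R) (Z : R -> V) (x v : V) : 0 <= t ->
  x = Psi 0 t (Z t) w ->
  is_derive t 1 Z (v *m 'J (fun y => Psi t 0 y w) x) ->
  is_derive t 1 (fun u => Psi 0 t (Z u) w) v.
Proof.
move=> t0 yE [dZ Z1].
have [_ _ dpsi _] := flow.
have ZE : Z t = Psi t 0 x w.
  by rewrite yE (C1_flow_cancel _ _ _ flow (lexx 0) t0).
have dg : differentiable (fun x => Psi 0 t x w) (Z t) by exact: dpsi.
have dZ' : differentiable Z t by apply/derivable1_diffP.
have dc := differentiable_comp dZ' dg.
split; first by apply/derivable1_diffP.
rewrite deriveE // (diff_comp dZ' dg) /= -[X in 'd _ _ X](deriveE _ dZ') Z1.
rewrite -(deriveE _ dg) (deriveEjacobian _ dg) -mulmxA ZE.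
rewrite (jacobian_cancel (fun x => Psi t 0 x w) (fun x => Psi 0 t x w)).
- by rewrite mulmx1.
- exact: (C1_flow_cancel _ _ _ flow t0 (lexx 0)).
- exact: dpsi.
- exact: dpsi.
Qed.

(** The approximating equations: a strictly inward drift keeps [D] invariant. *)
Lemma inward_drift_invariant (D : set V) s eta y : closed D ->
  (forall t t', 0 <= t -> t < t' -> (fun x => Psi t t' x w) @` D = D) ->
  (forall t zeta, 0 <= t -> pathC_in D zeta ->
     exists2 alpha : R, 0 < alpha & forall h u, 0 < h <= alpha ->
       enorm u <= alpha -> D (zeta (delay0 r) + h *: H t zeta w + h *: u)) ->
  0 <= s -> pathC_in D eta -> pathwise_solution Psi H w s eta y ->
  forall t, s <= t -> D (y t).
Proof.
move=> cD psiD inw s0 etaD sol.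
have [cy y0 _] := sol.
have sr : s - r%:num <= s by rewrite lerBlDr lerDl.
have Dinit u : s - r%:num <= u <= s -> D (y u).
  move=> /andP[su us].
  have uP : u - s \in delays r.
    by rewrite inE /delays /= in_itv /= subr_le0 us lerBrDr addrC su.
  by have := y0 (exist _ (u - s) uP); rewrite /= addrC subrK => ->; exact: etaD.
have cys : {within `[s, +oo[, continuous y}.
  apply: continuous_subspaceW cy => u /=.
  by rewrite !in_itv /= !andbT; exact: le_trans.
apply: closed_set_continuation => //.
  by apply: Dinit; rewrite sr lexx.
move=> t st Dt.
have t0 : 0 <= t := le_trans s0 st.
have [Z HZ] := pathwise_solution_lift s eta y s0 sol.
have [yE dZ] := HZ t st.
have dW := transported_derive t Z (y t) _ t0 yE dZ.
have segE (u : delays r) : segment r y t u = y (t + val u).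
  by apply: segment_within cy _; rewrite subrK.
have segD : pathC_in D (segment r y t).
  move=> u; rewrite segE; have /andP[ur u0] := delays_itv u.
  have [stu|/ltW stu] := leP s (t + val u).
    by apply: Dt; rewrite stu /= gerDl.
  by apply: Dinit; rewrite stu andbT lerD.
have [alpha a0 Ha] := inw t _ t0 segD.
have := inward_derivative_enters D _ t alpha _ dW a0.
rewrite -yE; rewrite segE /= addr0 in Ha => /(_ Ha) nearD.
near=> h.
have h0 : 0 < h by near: h; exact: nbhs_right_gt.
have th : t < t + h by rewrite ltrDl.
(* The cocycle property exhibits [y (t + h)] as the image under [Psi t (t + h)]
   of a point of [D]. *)
have [-> _] := HZ (t + h) (le_trans st (ltW th)).
have [_ psiM _ _] := flow.
rewrite (psiM 0 t (t + h)) ?(le_trans t0 (ltW th)) //.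
rewrite -(psiD t (t + h) t0 th).
exists (Psi 0 t (Z (t + h)) w) => //.
by near: h.
Unshelve. all: by end_near. Qed.

End PathwiseSolutions.
(** * Forward invariance *)

Lemma stochastic_flow_C1 (R : realType) (dsp : measure_display)
    (T : measurableType dsp) (P : probability T R) (F : R -> set (set T))
    (d : nat) (M : 'I_d -> R -> 'rV[R]_d -> T -> R)
    (a : 'I_d -> 'I_d -> R -> 'rV[R]_d -> 'rV[R]_d -> T -> R)
    (b : R -> 'rV[R]_d -> T -> 'rV[R]_d)
    (Psi : R -> R -> 'rV[R]_d -> T -> 'rV[R]_d) w :
  stochastic_flow P F M a b Psi -> C1_flow (fun s t x => Psi s t x w).
Proof.
move=> [_ psi1 [_ cJ] diffeo psiM]; split => [s x s0|s t u x|s t x s0 t0|].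
- exact: psi1.
- exact: psiM.
- by have [[dpsi _] _] := diffeo s t w s0 t0; exact: dpsi.
- exact: cJ.
Qed.

Theorem theorem3p4 (R : realType) (r : {posnum R}) (d : nat) (hd : (0 < d)%N)
    (dsp : measure_display) (T : measurableType dsp) (P : probability T R)
    (F : R -> set (set T)) (hF : filtration_usual P F)
    (D : set 'rV[R]_d) (D0 : D !=set0) (Dclosed : closed D)
    (M : 'I_d -> R -> 'rV[R]_d -> T -> R)
    (delta : R) (a : 'I_d -> 'I_d -> R -> 'rV[R]_d -> 'rV[R]_d -> T -> R)
    (hM : regular_local_martingale_field P F M delta a)
    (G H : R -> pathC r d -> T -> 'rV[R]_d) (b : R -> 'rV[R]_d -> T -> 'rV[R]_d)
    (hG : admissible_drift F G H b)
    (hH : sublinear_growth H)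
    (Psi : R -> R -> 'rV[R]_d -> T -> 'rV[R]_d)
    (hPsi : stochastic_flow P F M a b Psi)
    (hH_wp : pathwise_well_posed Psi H)
    (hPsiD : forall s t w, 0 <= s -> s < t ->
       (fun x => Psi s t x w) @` D = D)
    (eps0 : R) (heps0 : 0 < eps0)
    (Ge He : R -> R -> pathC r d -> T -> 'rV[R]_d)
    (hGe : forall eps, 0 < eps <= eps0 ->
       admissible_drift F (Ge eps) (He eps) b)
    (hHe : forall eps, 0 < eps <= eps0 -> sublinear_growth (He eps))
    (hHe_wp : forall eps, 0 < eps <= eps0 -> pathwise_well_posed Psi (He eps))
    (hHe_cvg : forall t eta w, 0 <= t -> pathC_in D eta ->
       He eps t eta w @[eps --> 0^'+] --> H t eta w)
    (hHe_inward : forall t eta eps w, 0 <= t -> pathC_in D eta ->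
       0 < eps <= eps0 ->
       exists2 alpha : R, 0 < alpha &
         forall h (u : 'rV[R]_d), 0 < h <= alpha -> enorm u <= alpha ->
           D (eta (delay0 r) + h *: He eps t eta w + h *: u))
    (hcvg : forall w s eta (y : R -> R -> 'rV[R]_d) (x : R -> 'rV[R]_d),
       0 <= s ->
       (forall eps, 0 < eps <= eps0 ->
          pathwise_solution Psi (He eps) w s eta (y eps)) ->
       pathwise_solution Psi H w s eta x ->
       forall t, s <= t -> y eps t @[eps --> 0^'+] --> x t) :
  forward_invariant Psi H D.
Proof.
move=> w s eta x s0 etaD solx t st.
(* For [eps] out of range any function serves as a value. *)
have solve eps : exists y, 0 < eps <= eps0 ->
    pathwise_solution Psi (He eps) w s eta y.
  have [/hHe_wp/(_ w s eta s0)[[y soly] _]|neps] := pselect (0 < eps <= eps0).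
    by exists y.
  by exists (fun=> 0) => heps; case: (neps heps).
have [y soly] := choice solve.
have yD eps : 0 < eps <= eps0 -> D (y eps t).
  move=> heps; have [_ _ [Hc _ _] _ _] := hGe eps heps.
  have flow := stochastic_flow_C1 _ _ _ _ _ _ _ _ _ _ w hPsi.
  have psiD u v : 0 <= u -> u < v -> (fun z => Psi u v z w) @` D = D.
    by move=> u0 uv; exact: hPsiD.
  exact: (inward_drift_invariant Psi (He eps) w flow (Hc w) D s eta (y eps)
    Dclosed psiD (fun u zeta u0 zetaD => hHe_inward u zeta eps w u0 zetaD heps)
    s0 etaD (soly eps heps) t st).
apply: (closed_cvg D Dclosed _ (x t) (hcvg w s eta y x s0 soly solx t st)).
near=> eps; apply: yD; apply/andP; split.
  by near: eps; exact: nbhs_right_gt.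
by near: eps; exact: nbhs_right_le.
Unshelve. all: by end_near. Qed.
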